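(* There exists an $E$-unitary finitely presented special inverse monoid $M$ (in fact, $M$ can be taken to be a free product of a finitely presented group with a finite rank free inverse monoid) such that every finite group is isomorphic to a group $\mathcal{H}$-class of $M$.
   Context: An inverse monoid is a monoid $M$ in which every $m\in M$ has a unique inverse $m^{-1}$ with $mm^{-1}m=m$ and $m^{-1}mm^{-1}=m^{-1}$. For an alphabet $A$ with formal inverses $A^{-1}$ and $A^{\pm1}=A\cup A^{-1}$, $\mathrm{Inv}\langle A\rangle$ denotes the free inverse monoid on $A$ (the quotient of the free monoid $(A^{\pm1})^*$ by the congruence generated by $ww^{-1}w=w$ and $uu^{-1}ww^{-1}=ww^{-1}uu^{-1}$ for all words $u,w$); its rank is $|A|$. $\mathrm{Inv}\langle A\mid R\rangle$ is its quotient by the congruence generated by $R\subseteq (A^{\pm1})^*\times(A^{\pm1})^*$. The presentation is special if every relation has the form $w=1$; a finitely presented special inverse monoid is one given by a special presentation with $A$ and $R$ finite. The maximal group image of $M=\mathrm{Inv}\langle A\mid R\rangle$ is the group $\mathrm{Gp}\langle A\mid R\rangle$, with canonical surjection $\sigma:M\to \mathrm{Gp}\langle A\mid R\rangle$; $M$ is $E$-unitary if $\sigma^{-1}(1)$ is exactly the set of idempotents of $M$. Elements $m,n\in M$ are $\mathcal{H}$-related if $mm^{-1}=nn^{-1}$ and $m^{-1}m=n^{-1}n$. A group $\mathcal{H}$-class (maximal subgroup) of $M$ is the $\mathcal{H}$-class $H_e$ of an idempotent $e\in M$; it is a group with identity $e$. The free product is taken in the category of inverse monoids. *)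

(* Defs.v *)
From HB Require Import structures.
From mathcomp Require Import all_boot fingroup.
From mathcomp Require Import generic_quotient boolp classical_sets functions cardinality.

Set Implicit Arguments.
Unset Strict Implicit.
Unset Printing Implicit Defensive.

Local Open Scope group_scope.
Local Open Scope classical_set_scope.
Local Open Scope quotient_scope.

HB.mixin Record StarMonoid_isInverseMonoid M of Monoid M & BaseGroup M := {
  mulgVg : forall x : M, x * x^-1 * x = x;
  mulVgV : forall x : M, x^-1 * x * x^-1 = x^-1;
  inverse_uniq : forall x y : M, x * y * x = x -> y * x * y = y -> y = x^-1
}.

(* The axioms of *-monoids follow from those of inverse monoids, as the next
   factory shows; inheriting from [StarMonoid] only keeps the hierarchy
   compatible with that of groups. *)
#[short(type="inverseMonoidType")]
HB.structure Definition InverseMonoid :=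
  {M of StarMonoid_isInverseMonoid M & StarMonoid M}.

HB.factory Record Monoid_isInverseMonoid M of Monoid M & BaseGroup M := {
  mulgVg : forall x : M, x * x^-1 * x = x;
  mulVgV : forall x : M, x^-1 * x * x^-1 = x^-1;
  inverse_uniq : forall x y : M, x * y * x = x -> y * x * y = y -> y = x^-1
}.

HB.builders Context M of Monoid_isInverseMonoid M.

Fact invgK : involutive (@monoid.inv M).
Proof. by move=> x; apply/esym/inverse_uniq; [exact: mulVgV|exact: mulgVg]. Qed.

Local Lemma idem_mul (e f : M) : e * e = e -> f * f = f ->
  e * f * (e * f) = e * f.
Proof.
move=> ee ff; set a := (e * f)^-1.
have aefa : a * (e * f) * a = a by apply: mulVgV.
have efaef : e * f * a * (e * f) = e * f by apply: mulgVg.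
have fae : f * a * e = a.
  apply: inverse_uniq.
  - transitivity (e * (f * f) * a * (e * e) * f); first by rewrite !mulgA.
    by rewrite ee ff -[RHS]efaef !mulgA.
  - transitivity (f * a * (e * e) * (f * f) * a * e); first by rewrite !mulgA.
    rewrite ee ff; transitivity (f * (a * (e * f) * a) * e); last by rewrite aefa.
    by rewrite !mulgA.
have aa : a * a = a.
  rewrite -{1 2}fae; transitivity (f * (a * (e * f) * a) * e).
    by rewrite !mulgA.
  by rewrite aefa fae.
have aV : a^-1 = a by apply/esym/inverse_uniq; rewrite !aa.
have aE : a = e * f by rewrite -aV /a invgK.
by rewrite -aE.
Qed.

Local Lemma idemV (e : M) : e * e = e -> e^-1 = e.
Proof. by move=> ee; apply/esym/inverse_uniq; rewrite !ee. Qed.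

Local Lemma idemC (e f : M) : e * e = e -> f * f = f -> e * f = f * e.
Proof.
move=> ee ff; have efi := idem_mul ee ff; have fei := idem_mul ff ee.
rewrite -(idemV efi); apply/esym/inverse_uniq.
- transitivity (e * (f * f) * (e * e) * f); first by rewrite !mulgA.
  by rewrite ee ff -[RHS]efi !mulgA.
- transitivity (f * (e * e) * (f * f) * e); first by rewrite !mulgA.
  by rewrite ee ff -[RHS]fei !mulgA.
Qed.

Fact invgM : {morph @monoid.inv M : x y / x * y >-> y * x}.
Proof.
move=> x y.
have C : y * y^-1 * (x^-1 * x) = x^-1 * x * (y * y^-1).
  by apply: idemC; rewrite mulgA ?mulgVg ?mulVgV.
apply/esym/inverse_uniq.
- transitivity (x * (y * y^-1 * (x^-1 * x)) * y); first by rewrite !mulgA.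
  by rewrite C !mulgA mulgVg -!mulgA (mulgA y) mulgVg.
- transitivity (y^-1 * (x^-1 * x * (y * y^-1)) * x^-1); first by rewrite !mulgA.
  by rewrite -C !mulgA mulVgV -!mulgA (mulgA x^-1) mulVgV.
Qed.

HB.instance Definition _ := Monoid_isStarMonoid.Build M invgK invgM.
HB.instance Definition _ :=
  StarMonoid_isInverseMonoid.Build M mulgVg mulVgV inverse_uniq.

HB.end.

Section InverseMonoidNotions.
Variable M : inverseMonoidType.

Definition idempotent_elt (e : M) : Prop := e * e = e.

Definition Hrel (m n : M) : Prop :=
  m * m^-1 = n * n^-1 /\ m^-1 * m = n^-1 * n.

Definition Hclass (e : M) : set M := [set m | Hrel m e].

End InverseMonoidNotions.

(* For [e] idempotent, [Hclass e] is a group under the multiplication of [M]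
   (with identity [e]), so an isomorphism onto it is a multiplicative
   bijection from [G] onto [Hclass e]. *)
Definition isog_Hclass (G : groupType) (M : inverseMonoidType) (e : M) : Prop :=
  exists f : G -> M, {morph f : x y / x * y} /\ set_bij [set: G] (Hclass e) f.

(* The coproduct in the category of inverse monoids; monoid morphisms between
   inverse monoids preserve inverses. *)
Definition is_free_product (M1 M2 M : inverseMonoidType)
    (i1 : M1 -> M) (i2 : M2 -> M) : Prop :=
  [/\ monoid_morphism i1, monoid_morphism i2 &
    forall (N : inverseMonoidType) (f1 : M1 -> N) (f2 : M2 -> N),
      monoid_morphism f1 -> monoid_morphism f2 ->
      exists! h : M -> N,
        [/\ monoid_morphism h, h \o i1 = f1 & h \o i2 = f2]].

(* The letter [(a, false)] stands for [a], and [(a, true)] for its formal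
   inverse. *)
Definition word (A : Type) := seq (A * bool).

Definition winv {A} (w : word A) : word A :=
  rev [seq (l.1, ~~ l.2) | l <- w].

Lemma winvK A : involutive (@winv A).
Proof.
move=> w; rewrite /winv map_rev revK -map_comp -[RHS]map_id.
by apply: eq_map => -[a b] /=; rewrite negbK.
Qed.

Lemma winv_cat A (u v : word A) : winv (u ++ v) = winv v ++ winv u.
Proof. by rewrite /winv map_cat rev_cat. Qed.

Inductive congruence_gen (A : Type) (E : set (word A * word A)) :
    word A -> word A -> Prop :=
| cong_rel u v : E (u, v) -> congruence_gen E u v
| cong_refl u : congruence_gen E u u
| cong_sym u v : congruence_gen E u v -> congruence_gen E v u
| cong_trans u v w :
    congruence_gen E u v -> congruence_gen E v w -> congruence_gen E u w
| cong_cat u u' v v' :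
    congruence_gen E u u' -> congruence_gen E v v' ->
    congruence_gen E (u ++ v) (u' ++ v').

Section PresentedMonoid.
Variables (A : choiceType) (E : set (word A * word A)).

Definition congb : rel (word A) := fun u v => `[< congruence_gen E u v >].

Fact congb_refl : reflexive congb.
Proof. by move=> u; apply/asboolP/cong_refl. Qed.

Fact congb_sym : symmetric congb.
Proof. by move=> u v; apply/asboolP/asboolP; apply: cong_sym. Qed.

Fact congb_trans : transitive congb.
Proof.
by move=> v u w /asboolP uv /asboolP vw; apply/asboolP/(cong_trans uv).
Qed.

Canonical congb_equiv := EquivRel congb congb_refl congb_sym congb_trans.

Definition Mon : Type := {eq_quot congb_equiv}.
HB.instance Definition _ := Choice.on Mon.
HB.instance Definition _ := Quotient.on Mon.

Definition Mon_class (w : word A) : Mon := \pi_Mon w.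

Lemma Mon_classP u v : Mon_class u = Mon_class v <-> congruence_gen E u v.
Proof.
split=> [/eqquotP/asboolP //|uv]; apply/eqquotP; exact/asboolP.
Qed.

Lemma Mon_reprK (x : Mon) : Mon_class (repr x) = x.
Proof. exact: reprK. Qed.

Lemma repr_Mon u : congruence_gen E (repr (Mon_class u)) u.
Proof. by apply/Mon_classP; rewrite Mon_reprK. Qed.

Definition Mon_mul (x y : Mon) : Mon := Mon_class (repr x ++ repr y).
Definition Mon_one : Mon := Mon_class [::].

Lemma Mon_mulE u v : Mon_mul (Mon_class u) (Mon_class v) = Mon_class (u ++ v).
Proof. by apply/Mon_classP/cong_cat; apply: repr_Mon. Qed.

Fact Mon_mulA : associative Mon_mul.
Proof.
move=> x y z; rewrite -[x]Mon_reprK -[y]Mon_reprK -[z]Mon_reprK.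
by rewrite !Mon_mulE catA.
Qed.

Fact Mon_mul1 : left_id Mon_one Mon_mul.
Proof. by move=> x; rewrite -[x]Mon_reprK Mon_mulE. Qed.

Fact Mon_mulr1 : right_id Mon_one Mon_mul.
Proof. by move=> x; rewrite -[x]Mon_reprK Mon_mulE cats0. Qed.

HB.instance Definition _ := isMonoid.Build Mon Mon_mulA Mon_mul1 Mon_mulr1.

(* This descends to classes only for suitable [E], such as those defining
   [InvPres] and [GpPres] below: see [Inv_invE] and [Gp_invE]. *)
Definition Mon_inv (x : Mon) : Mon := Mon_class (winv (repr x)).

Lemma Mon_classM u v : Mon_class (u ++ v) = Mon_class u * Mon_class v.
Proof. by rewrite -Mon_mulE. Qed.

End PresentedMonoid.

Definition inverse_rel (A : Type) : set (word A * word A) :=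
  [set p | exists w : word A, p = (w ++ winv w ++ w, w)] `|`
  [set p | exists u w : word A,
     p = (u ++ winv u ++ w ++ winv w, w ++ winv w ++ u ++ winv u)].

Definition InvPres (A : choiceType) (R : set (word A * word A)) : Type :=
  Mon (@inverse_rel A `|` R).

Definition FreeInv (A : choiceType) : Type := @InvPres A set0.

Section InvTheory.
Variables (A : choiceType) (R : set (word A * word A)).
HB.instance Definition _ := Monoid.on (InvPres R).
HB.instance Definition _ := hasInv.Build (InvPres R) (@Mon_inv A _).

Definition Inv_class (w : word A) : InvPres R := Mon_class _ w.

Local Notation c := Inv_class.

Let cM u v : c (u ++ v) = c u * c v.
Proof. exact: Mon_classM. Qed.

Let cVK w : c w * c (winv w) * c w = c w.
Proof.
rewrite -!cM -catA; apply/Mon_classP/cong_rel; left; left.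
by exists w.
Qed.

Let cVV w : c (winv w) * c w * c (winv w) = c (winv w).
Proof. by have := cVK (winv w); rewrite winvK. Qed.

Let cC u w : c u * c (winv u) * (c w * c (winv w)) =
             c w * c (winv w) * (c u * c (winv u)).
Proof.
rewrite -!cM -!catA; apply/Mon_classP/cong_rel; left; right.
by exists u, w.
Qed.

Let cCV u w : c (winv u) * c u * (c w * c (winv w)) =
              c w * c (winv w) * (c (winv u) * c u).
Proof. by have := cC (winv u) w; rewrite winvK. Qed.

Let idem_split (e : InvPres R) : e * e = e ->
  exists u v, e = c u * c (winv u) * (c v * c (winv v)).
Proof.
rewrite -[e]Mon_reprK -/(c (repr e)); move: (repr e) => w ww.
have zP : c (winv w) = c (winv w) * c w * (c w * c (winv w)).
  by rewrite mulgA -(mulgA (c (winv w))) ww cVV.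
have zz : c (winv w) * c (winv w) = c (winv w).
  rewrite [X in X * _]zP cCV [X in _ * X]zP.
  have -> (p q : InvPres R) : p * q * (q * p) = p * (q * q) * p.
    by rewrite !mulgA.
  by rewrite [c (winv w) * c w * _]mulgA cVV -cCV -mulgA [X in _ * X]mulgA cVK
     -zP.
exists w, (winv w); rewrite winvK.
by rewrite mulgA -(mulgA (c w)) zz cVK.
Qed.

Let idemC (e f : InvPres R) : e * e = e -> f * f = f -> e * f = f * e.
Proof.
move=> /idem_split[u1 [v1 ->]] /idem_split[u2 [v2 ->]].
set p1 := c u1 * _; set q1 := c v1 * _; set p2 := c u2 * _; set q2 := c v2 * _.
have C1 : p1 * p2 = p2 * p1 by apply: cC.
have C2 : p1 * q2 = q2 * p1 by apply: cC.
have C3 : q1 * p2 = p2 * q1 by apply: cC.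
have C4 : q1 * q2 = q2 * q1 by apply: cC.
transitivity (p1 * (q1 * p2) * q2); first by rewrite !mulgA.
rewrite C3; transitivity (p1 * p2 * (q1 * q2)); first by rewrite !mulgA.
rewrite C1 C4; transitivity (p2 * (p1 * q2) * q1); first by rewrite !mulgA.
by rewrite C2 !mulgA.
Qed.

Let inv_uniq (x y z : InvPres R) : x * y * x = x -> y * x * y = y ->
  x * z * x = x -> z * x * z = z -> y = z.
Proof.
move=> xy yx xz zx.
have yxi : (y * x) * (y * x) = y * x by rewrite mulgA yx.
have zxi : (z * x) * (z * x) = z * x by rewrite mulgA zx.
have xyi : (x * y) * (x * y) = x * y by rewrite mulgA xy.
have xzi : (x * z) * (x * z) = x * z by rewrite mulgA xz.
have E1 : y = y * x * z.
  transitivity (y * (x * z * (x * y))); first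
    by rewrite !mulgA -!(mulgA y) xz mulgA yx.
  by rewrite (idemC xzi xyi) !mulgA yx.
have E2 : z = y * x * z.
  transitivity (z * x * (y * x) * z); first
    by rewrite -(mulgA z x) (mulgA x y) xy zx.
  by rewrite (idemC zxi yxi) -!mulgA (mulgA z) zx.
by rewrite E1 -E2.
Qed.

Fact Inv_mulgVg (x : InvPres R) : x * x^-1 * x = x.
Proof. by have := cVK (repr x); rewrite /c Mon_reprK. Qed.

Fact Inv_mulVgV (x : InvPres R) : x^-1 * x * x^-1 = x^-1.
Proof. by have := cVV (repr x); rewrite /c Mon_reprK. Qed.

Fact Inv_inverse_uniq (x y : InvPres R) :
  x * y * x = x -> y * x * y = y -> y = x^-1.
Proof.
by move=> xy yx; apply: (inv_uniq xy yx); [exact: Inv_mulgVg|exact: Inv_mulVgV].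
Qed.

HB.instance Definition _ :=
  Monoid_isInverseMonoid.Build (InvPres R)
    Inv_mulgVg Inv_mulVgV Inv_inverse_uniq.

Lemma Inv_invE w : (Inv_class w)^-1 = Inv_class (winv w).
Proof. by apply/esym/inverse_uniq; [exact: cVK|exact: cVV]. Qed.

End InvTheory.

HB.instance Definition _ (A : choiceType) := InverseMonoid.on (FreeInv A).

Definition group_rel (A : Type) : set (word A * word A) :=
  [set p | exists w : word A, p = (w ++ winv w, [::])].

Definition GpPres (A : choiceType) (R : set (word A * word A)) : Type :=
  Mon (@group_rel A `|` R).

Section GpTheory.
Variables (A : choiceType) (R : set (word A * word A)).
HB.instance Definition _ := Monoid.on (GpPres R).
HB.instance Definition _ := hasInv.Build (GpPres R) (@Mon_inv A _).

Definition Gp_class (w : word A) : GpPres R := Mon_class _ w.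

Let cgV w : Gp_class w * Gp_class (winv w) = 1.
Proof.
rewrite -[LHS]Mon_classM; apply/Mon_classP/cong_rel; left; by exists w.
Qed.

Fact Gp_mulgV (x : GpPres R) : x * x^-1 = 1.
Proof. by have := cgV (repr x); rewrite /Gp_class Mon_reprK. Qed.

Fact Gp_mulVg (x : GpPres R) : x^-1 * x = 1.
Proof.
by have := cgV (winv (repr x)); rewrite winvK /Gp_class Mon_reprK.
Qed.

HB.instance Definition _ := Monoid_isGroup.Build (GpPres R) Gp_mulVg Gp_mulgV.

Fact Gp_mulgVg (x : GpPres R) : x * x^-1 * x = x.
Proof. by rewrite mulgV mul1g. Qed.

Fact Gp_mulVgV (x : GpPres R) : x^-1 * x * x^-1 = x^-1.
Proof. by rewrite mulVg mul1g. Qed.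

Fact Gp_inverse_uniq (x y : GpPres R) :
  x * y * x = x -> y * x * y = y -> y = x^-1.
Proof.
move=> xyx _; apply: (mulgI x); apply: (mulIg x).
by rewrite xyx Gp_mulgVg.
Qed.

HB.instance Definition _ :=
  StarMonoid_isInverseMonoid.Build (GpPres R)
    Gp_mulgVg Gp_mulVgV Gp_inverse_uniq.

Lemma Gp_invE w : (Gp_class w)^-1 = Gp_class (winv w).
Proof. by apply: (mulgI (Gp_class w)); rewrite mulgV cgV. Qed.

End GpTheory.

Definition special (A : Type) (R : set (word A * word A)) : Prop :=
  forall u v, R (u, v) -> v = [::].

Section MaximalGroupImage.
Variables (A : choiceType) (R : set (word A * word A)).

(* The canonical surjection; see [sigma_class]. *)
Definition sigma (x : InvPres R) : GpPres R := Gp_class R (repr x).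

Lemma congruence_inverse_group u v :
  congruence_gen (@inverse_rel A `|` R) u v ->
  congruence_gen (@group_rel A `|` R) u v.
Proof.
have V z : congruence_gen (@group_rel A `|` R) (z ++ winv z) [::].
  by apply: cong_rel; left; exists z.
elim=> {u v} [u v|u|u v _|u v x _ uv _|u u' v v' _ ? _ ?].
- case=> [[[x [-> ->]]|[x [y [-> ->]]]]|Ruv].
  + rewrite catA -[X in congruence_gen _ _ X]cat0s.
    by apply: cong_cat; [exact: V|exact: cong_refl].
  + rewrite catA (catA y); apply: (@cong_trans _ _ _ ([::] ++ [::])).
      by apply: cong_cat; exact: V.
    by apply: cong_sym; apply: cong_cat; exact: V.
  + by apply: cong_rel; right.
- exact: cong_refl.
- exact: cong_sym.
- exact: cong_trans.
- exact: cong_cat.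
Qed.

Lemma sigma_class w : sigma (Inv_class R w) = Gp_class R w.
Proof. by apply/Mon_classP/congruence_inverse_group/repr_Mon. Qed.

Definition E_unitary : Prop :=
  forall x : InvPres R, sigma x = 1 <-> idempotent_elt x.

End MaximalGroupImage.

(* Main.v *)
Require Import Defs.
From mathcomp Require Import all_boot fingroup all_order all_algebra.
From mathcomp Require Import zify lra.
From mathcomp Require Import generic_quotient boolp classical_sets functions.
From mathcomp Require Import cardinality.

(** Let G be a finitely presented group containing every finite group and let M
    be the free product of G with the free inverse monoid on x. For a finite
    subgroup H of G, the idempotent e = prod_(h in H) h x x^-1 h^-1 commutes
    with H, and H_e = H e: an element of M determines its image in the maximal
    group image K and the finite set of x-edges of the Cayley graph of K that
    it traverses; for e this set is H, so an element of H_e has an image k in K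
    with k H = H.

    M is E-unitary because each of its elements lies, in the natural order,
    below the normal form of its image in K, and the normal form of 1 is 1.

    For G we take three generators: t and u stand for the usual generators of
    Thompson's group F and s for a transposition. The relations of F make u act
    on the conjugates s_k = s^(t^k) as t does for k >= 2, so finitely many
    relations imply the Coxeter relations of all adjacent transpositions s_k;
    an action on the rational line, where s_k exchanges k and k + 1, shows that
    the s_k generate the finitary symmetric group. *)

Set Implicit Arguments.
Unset Strict Implicit.
Unset Printing Implicit Defensive.

Local Open Scope group_scope.
Local Open Scope classical_set_scope.

(** * Idempotents and the natural partial order *)

Section InverseMonoidTheory.
Variable M : inverseMonoidType.
Implicit Types a b c e f x : M.

Lemma idem_inv e : idempotent_elt e -> e^-1 = e.
Proof. by move=> ee; apply/esym/inverse_uniq; rewrite !ee. Qed.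

Lemma idem_mul e f :
  idempotent_elt e -> idempotent_elt f -> idempotent_elt (e * f).
Proof.
move=> ee ff; rewrite /idempotent_elt -[RHS]mulgVg invgM !idem_inv //.
by rewrite !mulgA -(mulgA e f f) ff -(mulgA (e * f) e e) ee.
Qed.

Lemma idem_comm e f : idempotent_elt e -> idempotent_elt f -> e * f = f * e.
Proof.
move=> ee ff; rewrite -(idem_inv (idem_mul ee ff)) invgM.
by rewrite !idem_inv.
Qed.

Lemma idem_mulgV x : idempotent_elt (x * x^-1).
Proof. by rewrite /idempotent_elt mulgA mulgVg. Qed.

Lemma idem_mulVg x : idempotent_elt (x^-1 * x).
Proof. by rewrite /idempotent_elt mulgA mulVgV. Qed.

Lemma idem_conj c e : idempotent_elt e -> idempotent_elt (c^-1 * e * c).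
Proof.
move=> ee; rewrite /idempotent_elt; transitivity
  (c^-1 * (e * (c * c^-1)) * e * c); first by rewrite !mulgA.
by rewrite (idem_comm ee (idem_mulgV c)) !mulgA mulVgV -(mulgA (c^-1) e) ee.
Qed.

Definition natural_le a b : Prop := exists2 f, idempotent_elt f & a = b * f.

Lemma natural_le_refl a : natural_le a a.
Proof.
by exists (a^-1 * a); [exact: idem_mulVg|rewrite mulgA mulgVg].
Qed.

Lemma natural_le_trans b a c :
  natural_le a b -> natural_le b c -> natural_le a c.
Proof.
move=> [f ff ->] [g gg ->]; exists (g * f); rewrite ?mulgA //.
exact: idem_mul.
Qed.

(** An idempotent passes [c] as its conjugate: f c = f (c c^-1) c = c (c^-1 f c), because [f] and
    [c * c^-1] commute. *)
Lemma natural_le_mulr c a b : natural_le a b -> natural_le (a * c) (b * c).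
Proof.
move=> [f ff ->]; exists (c^-1 * f * c); first exact: idem_conj.
transitivity (b * (f * (c * c^-1)) * c); last first.
  by rewrite (idem_comm ff (idem_mulgV c)) !mulgA.
by rewrite -!mulgA (mulgA c) mulgVg.
Qed.

Lemma natural_le_mul_idem a f : idempotent_elt f -> natural_le (a * f) a.
Proof. by exists f. Qed.

Lemma natural_le_idem a : natural_le a 1 -> idempotent_elt a.
Proof. by move=> [f ff ->]; rewrite mul1g. Qed.

End InverseMonoidTheory.

Lemma monoid_morphismV (M N : inverseMonoidType) (f : M -> N) x :
  monoid_morphism f -> f x^-1 = (f x)^-1.
Proof.
move=> [_ fM]; apply: inverse_uniq.
  by rewrite -!fM mulgVg.
by rewrite -!fM mulVgV.
Qed.

(** * Finite products of idempotents *)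

Section IdempotentProducts.
Variables (T : eqType) (M : inverseMonoidType) (F : T -> M).
Hypothesis F_idem : forall t, idempotent_elt (F t).

Lemma prod_idem (s : seq T) : idempotent_elt (\prod_(t <- s) F t).
Proof.
elim: s => [|t s ih]; first by rewrite big_nil /idempotent_elt mul1g.
by rewrite big_cons; apply: idem_mul.
Qed.

Lemma prod_idem_absorb (s : seq T) t :
  t \in s -> (\prod_(r <- s) F r) * F t = \prod_(r <- s) F r.
Proof.
elim: s => //= r s ih; rewrite inE big_cons => /orP[/eqP->|ts]; last first.
  by rewrite -mulgA ih.
by rewrite (idem_comm (F_idem r) (prod_idem s)) -mulgA F_idem.
Qed.

Lemma prod_idem_sub (s s' : seq T) : {subset s' <= s} ->
  (\prod_(r <- s) F r) * (\prod_(r <- s') F r) = \prod_(r <- s) F r.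
Proof.
elim: s' => [|t s' ih] ss'; first by rewrite big_nil mulg1.
rewrite big_cons mulgA prod_idem_absorb ?ih //; last by rewrite ss' ?inE ?eqxx.
by move=> r rs'; rewrite ss' // inE rs' orbT.
Qed.

(** Idempotents form a semilattice, so each product absorbs the other. This later allows a group to
    permute the factors of such a product. *)
Lemma eq_prod_idem (s s' : seq T) :
  s =i s' -> \prod_(r <- s) F r = \prod_(r <- s') F r.
Proof.
move=> ss'; rewrite -(@prod_idem_sub s s'); last by move=> r; rewrite ss'.
rewrite idem_comm; try exact: prod_idem.
by rewrite prod_idem_sub // => r; rewrite ss'.
Qed.

End IdempotentProducts.

(** * Classes of words and the map to the maximal group image *)

Section PresentationTheory.
Variables (A : choiceType) (R : set (word A * word A)).

Lemma Inv_class_cat u v : Inv_class R (u ++ v) = Inv_class R u * Inv_class R v.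
Proof. exact: Mon_classM. Qed.

Lemma Inv_class_nil : Inv_class R [::] = 1.
Proof. by []. Qed.

Lemma Inv_class_repr (x : InvPres R) : Inv_class R (repr x) = x.
Proof. exact: Mon_reprK. Qed.

Lemma Gp_class_cat u v : Gp_class R (u ++ v) = Gp_class R u * Gp_class R v.
Proof. exact: Mon_classM. Qed.

Lemma Gp_class_nil : Gp_class R [::] = 1.
Proof. by []. Qed.

Lemma Gp_class_repr (x : GpPres R) : Gp_class R (repr x) = x.
Proof. exact: Mon_reprK. Qed.

Lemma Gp_class_eq u v :
  Gp_class R u = Gp_class R v <->
  congruence_gen (@group_rel A `|` R) u v.
Proof. exact: Mon_classP. Qed.

Lemma Inv_class_eq u v :
  Inv_class R u = Inv_class R v <->
  congruence_gen (@inverse_rel A `|` R) u v.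
Proof. exact: Mon_classP. Qed.

Lemma sigmaM : {morph @sigma A R : x y / x * y}.
Proof.
move=> x y; rewrite -[x]Inv_class_repr -[y]Inv_class_repr -Inv_class_cat.
by rewrite !sigma_class Gp_class_cat.
Qed.

Lemma sigma_idem x : idempotent_elt x -> sigma (R := R) x = 1.
Proof.
move=> xx; apply: (mulgI (sigma x)).
by rewrite -sigmaM xx mulg1.
Qed.

Lemma winv_cons (l : A * bool) w : winv (l :: w) = winv w ++ [:: (l.1, ~~ l.2)].
Proof. by rewrite /winv /= rev_cons cats1. Qed.

End PresentationTheory.

(** * Maps out of presented inverse monoids and groups *)

Section WordProduct.
Variables (A : choiceType) (N : inverseMonoidType) (phi : A * bool -> N).

Definition word_prod (w : word A) : N := \prod_(l <- w) phi l.

Lemma word_prod_cat u v : word_prod (u ++ v) = word_prod u * word_prod v.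
Proof. exact: big_cat. Qed.

Hypothesis phiV : forall l, phi (l.1, ~~ l.2) = (phi l)^-1.

Lemma word_prod_winv w : word_prod (winv w) = (word_prod w)^-1.
Proof.
elim: w => [|l w ih]; first by rewrite /word_prod !big_nil invg1.
rewrite winv_cons word_prod_cat ih -[l :: w]cat1s word_prod_cat invgM.
by rewrite /word_prod !big_cons !big_nil !mulg1 phiV.
Qed.

Variable R : set (word A * word A).
Hypothesis phiR : forall u v, R (u, v) -> word_prod u = word_prod v.

Lemma word_prod_Inv u v :
  Inv_class R u = Inv_class R v -> word_prod u = word_prod v.
Proof.
move=> /Inv_class_eq; elim=> {u v} [u v|u|u v _|u v x _ uv _|u u' v v' _ E _ E'].
- case=> [[[x [-> ->]]|[x [y [-> ->]]]]|/phiR //].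
    by rewrite !word_prod_cat !word_prod_winv mulgA mulgVg.
  rewrite !word_prod_cat !word_prod_winv !(mulgA _ (word_prod _)^-1).
  rewrite [LHS]mulgA [RHS]mulgA -!(mulgA (_ * _)).
  by rewrite idem_comm //; exact: idem_mulgV.
- by [].
- by [].
- by move=> <-.
- by rewrite !word_prod_cat E E'.
Qed.

(** Here [N] is only an inverse monoid, but the letters go to its units: applied to the formal
    inverse of [l], the hypothesis also gives (phi l)^-1 (phi l) = 1. *)
Lemma word_prod_Gp u v : (forall l, phi l * (phi l)^-1 = 1) ->
  Gp_class R u = Gp_class R v -> word_prod u = word_prod v.
Proof.
move=> phi1 /Gp_class_eq.
elim=> {u v} [u v|u|u v _|u v x _ uv _|u u' v v' _ E _ E'].
- case=> [[w [-> ->]]|/phiR //].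
  rewrite word_prod_cat word_prod_winv [RHS]/word_prod big_nil.
  elim: w => [|l w ih]; first by rewrite /word_prod !big_nil mul1g invg1.
  rewrite /word_prod big_cons -/(word_prod w) invgM -mulgA.
  by rewrite (mulgA (word_prod w)) ih mul1g.
- by [].
- by [].
- by move=> <-.
- by rewrite !word_prod_cat E E'.
Qed.

End WordProduct.

Lemma word_prod_morph (A : choiceType) (R : set (word A * word A))
    (N : inverseMonoidType) (f : InvPres R -> N) w : monoid_morphism f ->
  f (Inv_class R w) = word_prod (fun l => f (Inv_class R [:: l])) w.
Proof.
move=> [f1 fM]; elim: w => [|l w ih]; first by rewrite /word_prod big_nil -f1.
by rewrite -cat1s Inv_class_cat fM ih word_prod_cat /word_prod big_seq1.
Qed.

Lemma word_prod_Gp_morph (A : choiceType) (R : set (word A * word A))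
    (N : inverseMonoidType) (f : GpPres R -> N) w : monoid_morphism f ->
  f (Gp_class R w) = word_prod (fun l => f (Gp_class R [:: l])) w.
Proof.
move=> [f1 fM]; elim: w => [|l w ih]; first by rewrite /word_prod big_nil -f1.
by rewrite -cat1s Gp_class_cat fM ih word_prod_cat /word_prod big_seq1.
Qed.

(** * A presentation of the free product of a group and a free inverse monoid *)

Section FreeProduct.
Variables (B X : choiceType) (S : set (word B * word B)).
Let A : choiceType := (B + X)%type.

Definition wordl (w : word B) : word A := [seq (inl l.1, l.2) | l <- w].
Definition wordr (w : word X) : word A := [seq (inr l.1, l.2) | l <- w].

Lemma wordl_cat u v : wordl (u ++ v) = wordl u ++ wordl v.
Proof. exact: map_cat. Qed.

Lemma wordr_cat u v : wordr (u ++ v) = wordr u ++ wordr v.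
Proof. exact: map_cat. Qed.

(* The first summand makes the letters from [B] invertible by special
   relations. *)
Definition free_product_rel : set (word A * word A) :=
  range (fun l : B * bool =>
    ([:: (inl l.1, l.2); (inl l.1, ~~ l.2)], [::])) `|`
  (fun p => (wordl p.1, wordl p.2)) @` S.

Local Notation R := free_product_rel.
Local Notation M := (InvPres R).
Local Notation cl := (Inv_class R).

Lemma special_free_product : special S -> special R.
Proof.
by move=> spS u v [[l _ [_ <-]] //|[[u' v'] /= /spS-> [_ <-]]].
Qed.

Lemma Inv_class_inl (l : B * bool) :
  cl (wordl [:: l]) * (cl (wordl [:: l]))^-1 = 1.
Proof.
rewrite Inv_invE -Inv_class_cat.
by apply/Inv_class_eq/cong_rel; right; left; exists l.
Qed.

(** The letters from [B] go to units that satisfy the relations [S], so the group maps to [M]. Hence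
    [inc_group] does not depend on the chosen representative. *)
Lemma Inv_class_wordl u v :
  Gp_class S u = Gp_class S v -> cl (wordl u) = cl (wordl v).
Proof.
pose phi l := cl (wordl [:: l]).
have phiE w : cl (wordl w) = word_prod phi w.
  elim: w => [|l w ih]; first by rewrite /word_prod big_nil.
  by rewrite /word_prod big_cons -/(word_prod _ _) -ih -Inv_class_cat.
rewrite !phiE; apply: word_prod_Gp => [l|u' v' Suv|l].
- by rewrite /phi Inv_invE.
- rewrite -!phiE; apply/Inv_class_eq/cong_rel; right; right.
  by exists (u', v').
- exact: Inv_class_inl.
Qed.

Lemma Inv_class_wordr u v :
  Inv_class set0 u = Inv_class set0 v -> cl (wordr u) = cl (wordr v).
Proof.
pose phi l := cl (wordr [:: l]).
have phiE w : cl (wordr w) = word_prod phi w.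
  elim: w => [|l w ih]; first by rewrite /word_prod big_nil.
  by rewrite /word_prod big_cons -/(word_prod _ _) -ih -Inv_class_cat.
rewrite !phiE; apply: word_prod_Inv => [l|//].
by rewrite /phi Inv_invE.
Qed.

Definition inc_group (g : GpPres S) : M := cl (wordl (repr g)).
Definition inc_free (x : FreeInv X) : M := cl (wordr (repr x)).

Lemma inc_group_class w : inc_group (Gp_class S w) = cl (wordl w).
Proof. by apply: Inv_class_wordl; rewrite Gp_class_repr. Qed.

Lemma inc_free_class w : inc_free (Inv_class set0 w) = cl (wordr w).
Proof. by apply: Inv_class_wordr; rewrite Inv_class_repr. Qed.

Lemma inc_group_morph : monoid_morphism inc_group.
Proof.
split; first exact: (inc_group_class [::]).
move=> x y; rewrite -[x]Gp_class_repr -[y]Gp_class_repr -Gp_class_cat.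
by rewrite !inc_group_class wordl_cat Inv_class_cat.
Qed.

Lemma inc_free_morph : monoid_morphism inc_free.
Proof.
split; first exact: (inc_free_class [::]).
move=> x y; rewrite -[x]Inv_class_repr -[y]Inv_class_repr -Inv_class_cat.
by rewrite !inc_free_class wordr_cat Inv_class_cat.
Qed.

Lemma free_product_univ : is_free_product inc_group inc_free.
Proof.
split; [exact: inc_group_morph|exact: inc_free_morph|move=> N f1 f2 f1m f2m].
pose phi (l : A * bool) : N := match l.1 with
  | inl b => f1 (Gp_class S [:: (b, l.2)])
  | inr x => f2 (Inv_class set0 [:: (x, l.2)]) end.
have phiV l : phi (l.1, ~~ l.2) = (phi l)^-1.
  case: l => [[b|x] e] /=; rewrite -monoid_morphismV //.
    by rewrite Gp_invE.
  by rewrite Inv_invE.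
have phil w : word_prod phi (wordl w) = f1 (Gp_class S w).
  rewrite word_prod_Gp_morph // /word_prod /wordl big_map.
  by apply: eq_bigr => -[].
have phir w : word_prod phi (wordr w) = f2 (Inv_class set0 w).
  rewrite word_prod_morph // /word_prod /wordr big_map.
  by apply: eq_bigr => -[].
have phiR u v : R (u, v) -> word_prod phi u = word_prod phi v.
  case=> [[l _ [<- <-]]|[[u' v'] /= Suv [<- <-]]].
    have := phil [:: l; (l.1, ~~ l.2)]; rewrite /= => ->.
    rewrite -[LHS]/(f1 (Gp_class S ([:: l] ++ winv [:: l]))).
    rewrite Gp_class_cat -Gp_invE mulgV f1m.1.
    by rewrite /word_prod big_nil.
  by rewrite !phil; congr f1; apply/Gp_class_eq/cong_rel; right.
exists (fun x => word_prod phi (repr x)).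
have hE w : word_prod phi (repr (cl w)) = word_prod phi w.
  by apply: (word_prod_Inv phiV phiR); rewrite Inv_class_repr.
split=> [|h' [h'm h'l h'r]].
  split.
  - split; first by rewrite -Inv_class_nil hE /word_prod big_nil.
    move=> x y; rewrite -[x]Inv_class_repr -[y]Inv_class_repr -Inv_class_cat.
    by rewrite !hE word_prod_cat.
  - by apply/funext => g /=; rewrite hE phil Gp_class_repr.
  - by apply/funext => g /=; rewrite hE phir Inv_class_repr.
(* Uniqueness: a morphism is determined by its values on letters. *)
apply/funext => x; rewrite -[in RHS](Inv_class_repr x) word_prod_morph //.
apply: eq_bigr => -[[b|y] e] _ /=.
  by rewrite /phi /= -h'l /= inc_group_class.
by rewrite /phi /= -h'r /= inc_free_class.
Qed.

End FreeProduct.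

(** * Normal forms in the group image, and E-unitarity *)

Section NormalForms.
Variables (B X : choiceType) (S : set (word B * word B)).
Let A : choiceType := (B + X)%type.
Local Notation R := (@free_product_rel B X S).
Local Notation G := (GpPres S).
Local Notation cl := (Inv_class R).

(* The pair [([:: (g_n, y_n); ...; (g_1, y_1)], g)] stands for the element
   g_1 y_1 ... g_n y_n g, with the y_i letters from [X] or their inverses. *)
Definition nform : Type := (seq (G * (X * bool)) * G)%type.

Implicit Types (p : nform) (l : A * bool).

(** The list runs backwards, so [a] is the syllable after [b]: they cancel when the group element
    between their two letters is 1 and the letters are mutually inverse. *)
Definition non_cancelling (a b : G * (X * bool)) : bool :=
  ~~ ((a.1 == 1) && (b.2 == (a.2.1, ~~ a.2.2))).

Definition nf_reduced p : bool := sorted non_cancelling p.1.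

Definition nf_step p l : nform :=
  match l.1 with
  | inl b => (p.1, p.2 * Gp_class S [:: (b, l.2)])
  | inr x =>
    match p.1 with
    | a :: s => if (p.2 == 1) && (a.2 == (x, ~~ l.2)) then (s, a.1)
                else ((p.2, (x, l.2)) :: p.1, 1)
    | [::] => ([:: (p.2, (x, l.2))], 1)
    end
  end.

Lemma nf_step_reduced p l : nf_reduced p -> nf_reduced (nf_step p l).
Proof.
case: p l => [[|a s] g] [[b|x] e] //=; rewrite /nf_reduced /nf_step /=.
by case: ifP => /= [_ /path_sorted //|c ->]; rewrite /non_cancelling /= c.
Qed.

Lemma nf_stepK p l : nf_reduced p -> nf_step (nf_step p l) (l.1, ~~ l.2) = p.
Proof.
case: p l => [s g] [[b|x] e] /=; rewrite /nf_reduced /nf_step /=.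
  move=> _; congr pair.
  rewrite -[Gp_class S [:: (b, ~~ e)]]/(Gp_class S (winv [:: (b, e)])).
  by rewrite -Gp_invE mulgK.
case: s => [_|a s /=]; first by rewrite /= negbK !eqxx.
case: ifP => [/andP[/eqP-> /eqP aE] sP|_ _] /=; last by rewrite /= negbK !eqxx.
(* After a cancellation the inverse letter must be pushed back; it cannot cancel against [b],
   because the form was reduced. *)
case: s sP => [_|b s /= /andP[/negbTE ab _]].
  by rewrite -aE -surjective_pairing.
by case: a aE ab => g' y /= -> /=; rewrite /non_cancelling /= => ->.
Qed.

Lemma nf_steps_reduced p w : nf_reduced p -> nf_reduced (foldl nf_step p w).
Proof. by elim: w p => //= l w ih p pr; apply/ih/nf_step_reduced. Qed.

Lemma nf_steps_winv p w :
  nf_reduced p -> foldl nf_step p (w ++ winv w) = p.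
Proof.
elim: w p => //= l w ih p pr.
by rewrite winv_cons catA foldl_cat ih ?nf_step_reduced //= nf_stepK.
Qed.

Lemma nf_steps_wordl p w :
  foldl nf_step p (wordl X w) = (p.1, p.2 * Gp_class S w).
Proof.
elim: w p => [|l w ih] p; first by rewrite /= mulg1 -surjective_pairing.
by rewrite /= ih /= -mulgA -Gp_class_cat; case: l.
Qed.

(** Van der Waerden's argument: on reduced forms, a letter and its formal inverse act as mutually
    inverse permutations and the relations hold, so the maximal group image acts. *)
Lemma nf_steps_Gp u v p : nf_reduced p ->
  Gp_class R u = Gp_class R v -> foldl nf_step p u = foldl nf_step p v.
Proof.
move=> pr /Gp_class_eq uv.
elim: uv p pr => {u v} [u v|//|u v _ E p pr|u v w _ E _ E' p pr|
  u u' v v' _ E _ E' p pr].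
- case=> [[w [-> ->]]|[[l _ [<- <-]]|[[u' v'] /= Suv [<- <-]]]] p pr.
  + by rewrite nf_steps_winv.
  + have := nf_steps_winv [:: (inl l.1, l.2)] pr; exact.
  + rewrite !nf_steps_wordl; congr (_, _ * _).
    by apply/Gp_class_eq/cong_rel; right.
- by rewrite E.
- by rewrite E ?E'.
- by rewrite !foldl_cat E // E' // nf_steps_reduced.
Qed.

Definition nf_eval p : InvPres R :=
  (\prod_(a <- rev p.1) (inc_group X a.1 * cl (wordr B [:: a.2]))) *
  inc_group X p.2.

Lemma nf_eval_push s g y :
  nf_eval ((g, y) :: s, 1) = nf_eval (s, g) * cl (wordr B [:: y]).
Proof.
rewrite /nf_eval /= rev_cons -cats1 big_cat big_seq1 /=.
by rewrite (inc_group_morph X S).1 mulg1 mulgA.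
Qed.

(** Both sides are equal unless a letter cancels; then the step drops an idempotent y y^-1, which
    can only go up in the natural order. *)
Lemma nf_eval_step p l :
  natural_le (nf_eval p * cl [:: l]) (nf_eval (nf_step p l)).
Proof.
case: p l => [s g] [[b|x] e] /=.
  rewrite /nf_step /nf_eval /= (inc_group_morph X S).2 inc_group_class mulgA.
  exact: natural_le_refl.
have push s' : natural_le (nf_eval (s', g) * cl [:: (inr x, e)])
    (nf_eval ((g, (x, e)) :: s', 1)).
  by rewrite nf_eval_push; exact: natural_le_refl.
rewrite /nf_step /=; case: s => [|[g' y] s] /=; first exact: push.
case: ifP => [/andP[/eqP-> /eqP->]|_]; last exact: push.
rewrite nf_eval_push -mulgA; apply: natural_le_mul_idem.
have -> : cl (wordr B [:: (x, ~~ e)]) = (cl [:: (inr x, e)])^-1.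
  by rewrite Inv_invE.
exact: idem_mulVg.
Qed.

Lemma nf_eval_steps w :
  natural_le (cl w) (nf_eval (foldl nf_step ([::], 1) w)).
Proof.
elim/last_ind: w => [|w l ih].
  rewrite /nf_eval /= big_nil mul1g (inc_group_morph X S).1.
  exact: natural_le_refl.
rewrite foldl_rcons -cats1 Inv_class_cat.
apply: natural_le_trans (nf_eval_step _ _).
exact: natural_le_mulr.
Qed.

Lemma E_unitary_free_product : E_unitary R.
Proof.
move=> x; split; last exact: sigma_idem.
rewrite -[x]Inv_class_repr sigma_class -Gp_class_nil => /nf_steps_Gp E.
apply: natural_le_idem.
have := nf_eval_steps (repr x); rewrite E // /nf_eval /= big_nil mul1g.
by rewrite (inc_group_morph X S).1.
Qed.

End NormalForms.

(** * Traversed edges of the Cayley graph, and group H-classes *)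

Section TraversedEdges.
Variables (B X : choiceType) (S : set (word B * word B)).
Let A : choiceType := (B + X)%type.
Local Notation R := (@free_product_rel B X S).
Local Notation K := (GpPres R).
Local Notation cl := (Inv_class R).
Local Notation gp := (Gp_class R).

Definition shift (k : K) (P : set K) : set K := *%g k @` P.

Lemma shift1 P : shift 1 P = P.
Proof.
rewrite /shift (_ : *%g 1 = id) ?image_id //.
by apply/funext => a; rewrite mul1g.
Qed.

Lemma shiftM k k' P : shift k (shift k' P) = shift (k * k') P.
Proof.
rewrite /shift image_comp; congr (_ @` _).
by apply/funext => a /=; rewrite mulgA.
Qed.

Lemma shiftU k P Q : shift k (P `|` Q) = shift k P `|` shift k Q.
Proof. exact: image_setU. Qed.

Lemma shift0 k : shift k set0 = set0.
Proof. exact: image_set0. Qed.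

Lemma shift_set1 k a : shift k [set a] = [set k * a].
Proof. exact: image_set1. Qed.

(* The origins of the edges labelled in [X] traversed, in either direction, by
   a word read from the vertex 1 of the Cayley graph of the group image. *)
Fixpoint traversed (w : word A) : set K :=
  match w with
  | [::] => set0
  | (inl b, e) :: w' => shift (gp [:: (inl b, e)]) (traversed w')
  | (inr x, e) :: w' => [set if e then gp [:: (inr x, e)] else 1] `|`
                        shift (gp [:: (inr x, e)]) (traversed w')
  end.

(** The path of [v] starts at the vertex where that of [u] ends. Thus the pair of [traversed] and
    [gp] is a morphism to the semidirect product of the subsets of [K], under union, with [K]. *)
Lemma traversed_cat u v :
  traversed (u ++ v) = traversed u `|` shift (gp u) (traversed v).
Proof.
elim: u => [|l u ih]; first by rewrite set0U shift1.
rewrite -(cat1s l u) Gp_class_cat -shiftM.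
case: l => [[b|x] e] /=; rewrite ih shiftU //.
by rewrite setUA.
Qed.

(** The inverse word runs back along the path of [w], translated so as to end at 1. *)
Lemma traversed_winv w : traversed (winv w) = shift (gp w)^-1 (traversed w).
Proof.
elim: w => [|l w ih]; first by rewrite shift0.
rewrite winv_cons traversed_cat ih -Gp_invE -(cat1s l w) traversed_cat.
rewrite Gp_class_cat invgM -!shiftM !shiftU setUC.
rewrite (shiftM (gp [:: l])^-1) mulVg shift1.
congr (shift _ _ `|` _).
case: l => [[b|x] e] /=; rewrite !shift0 // !setU0 shift_set1 Gp_invE.
by case: e => //=; rewrite ?mulg1 // -Gp_invE mulVg.
Qed.

Lemma traversed_wordl w : traversed (wordl X w) = set0.
Proof. by elim: w => //= l w ->; rewrite shift0. Qed.

(** The word w w^-1 w only retraces the edges of w, both sides of the commutation relation traverse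
    the edges of u and of w from 1, and the words in [R] have no letters from [X]. *)
Lemma traversed_Inv u v : cl u = cl v -> traversed u = traversed v.
Proof.
move=> uv; have: gp u = gp v by rewrite -!sigma_class uv.
move/Inv_class_eq: uv; elim=> {u v} [u v|//|u v _ E /esym/E//|
  u v w /Inv_class_eq uv E _ E' uw|
  u u' v v' /Inv_class_eq uu' E /Inv_class_eq vv' E' _].
- case=> [[[w [-> ->]]|[x [y [-> ->]]]]|
      [[l _ [<- <-]]|[[u' v'] /= Suv [<- <-]]]] _.
  + rewrite !traversed_cat traversed_winv shiftU !shiftM -Gp_invE mulgV shift1.
    by rewrite !setUid.
  + rewrite !traversed_cat !traversed_winv !shiftU !shiftM -!Gp_invE.
    by rewrite !mulgV !shift1 !setUA !setUid !mul1g mulgV !shift1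
               -!setUA !setUid setUC.
  + by rewrite /= !shift0.
  + by rewrite !traversed_wordl.
- have guv : gp u = gp v by rewrite -!sigma_class uv.
  by rewrite E // E' // -guv.
- have gu : gp u = gp u' by rewrite -!sigma_class uu'.
  have gv : gp v = gp v' by rewrite -!sigma_class vv'.
  by rewrite !traversed_cat E // E' // gu.
Qed.

Definition edges (m : InvPres R) : set K := traversed (repr m).

Lemma edges_class w : edges (cl w) = traversed w.
Proof. by apply: traversed_Inv; rewrite Inv_class_repr. Qed.

Lemma edgesM m n : edges (m * n) = edges m `|` shift (sigma m) (edges n).
Proof.
rewrite -[m]Inv_class_repr -[n]Inv_class_repr -Inv_class_cat !edges_class.
by rewrite traversed_cat sigma_class.
Qed.

Lemma edges1 : edges 1 = set0.
Proof. exact: (edges_class [::]). Qed.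

Lemma sigmaV (m : InvPres R) : sigma m^-1 = (sigma m)^-1.
Proof.
by rewrite -[m]Inv_class_repr Inv_invE !sigma_class Gp_invE.
Qed.

Lemma edgesV m : edges m^-1 = shift (sigma m)^-1 (edges m).
Proof.
rewrite -[m]Inv_class_repr Inv_invE !edges_class sigma_class.
exact: traversed_winv.
Qed.

(** With [edges_mulVg], this shows what an H-class remembers: the edge set seen from the start and
    from the end of the path. *)
Lemma edges_mulgV m : edges (m * m^-1) = edges m.
Proof. by rewrite edgesM edgesV shiftM mulgV shift1 setUid. Qed.

Lemma edges_mulVg m : edges (m^-1 * m) = shift (sigma m)^-1 (edges m).
Proof. by rewrite edgesM edgesV sigmaV setUid. Qed.

Lemma edges_inc_group g : edges (inc_group X g) = set0.
Proof. by rewrite edges_class traversed_wordl. Qed.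

(** The action on normal forms recovers the group element: a word over [B] sends the empty form to
    its own class in the second component. *)
Lemma sigma_inc_group_inj :
  injective (fun g => sigma (inc_group X g : InvPres R)).
Proof.
move=> g h; rewrite !sigma_class => E.
have nf_red : nf_reduced (([::], 1) : nform X S) by [].
have := nf_steps_Gp nf_red E; rewrite !nf_steps_wordl => -[].
by rewrite !mul1g !Gp_class_repr.
Qed.

Lemma isog_Hclass_subgroup (H : finGroupType) (f : H -> GpPres S) (x : X) :
  {morph f : g h / g * h} -> injective f ->
  exists e : InvPres R, idempotent_elt e /\ isog_Hclass H e.
Proof.
move=> fM f_inj; pose i := @inc_group B X S; have im := inc_group_morph X S.
pose u h : InvPres R := i (f h); pose c : InvPres R := cl [:: (inr x, false)].
have uM g h : u (g * h) = u g * u h by rewrite /u fM /i im.2.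
have uV h : u h * (u h)^-1 = 1.
  by rewrite /u -(monoid_morphismV _ im) -im.2 mulgV im.1.
have Vu h : (u h)^-1 * u h = 1.
  by rewrite /u -(monoid_morphismV _ im) -im.2 mulVg im.1.
pose F h := u h * c * (u h * c)^-1.
have F_idem h : idempotent_elt (F h) by exact: idem_mulgV.
pose e := \prod_(h <- enum H) F h.
have ee : idempotent_elt e by exact: prod_idem.
have eV := idem_inv ee.
(* Moving [u h] past [F g] turns it into [F (h * g)], and translation by [h] permutes the
   factors. *)
have ue h : u h * e = e * u h.
  have uF (s : seq H) :
      u h * \prod_(g <- s) F g = \prod_(g <- map ( *%g h) s) F g * u h.
    elim: s => [|g s ih]; first by rewrite !big_nil mulg1 mul1g.
    rewrite /= !big_cons -[RHS]mulgA -ih !mulgA; congr (_ * _).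
    by rewrite /F uM !invgM !mulgA -(mulgA _ (u h)^-1) Vu mulg1.
  rewrite uF; congr (_ * _); apply: (eq_prod_idem F_idem) => g.
  rewrite mem_enum; apply/mapP; exists (h^-1 * g); first by rewrite mem_enum.
  by rewrite mulgA mulgV mul1g.
have edgesF h : edges (F h) = [set sigma (u h)].
  rewrite edges_mulgV edgesM /u edges_inc_group set0U edges_class /= shift0 setU0.
  by rewrite shift_set1 mulg1.
have edges_prod (s : seq H) : edges (\prod_(h <- s) F h) =
    [set k | exists2 h, h \in s & k = sigma (u h)].
  elim: s => [|h s ih].
    by rewrite big_nil edges1; apply/seteqP; split=> k // -[].
  rewrite big_cons edgesM (sigma_idem (F_idem h)) shift1 ih edgesF.
  apply/seteqP; split=> [k /= [->|[g gs ->]]|k /= [g]].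
  - by exists h; rewrite ?mem_head.
  - by exists g; rewrite // inE gs orbT.
  - by rewrite inE => /orP[/eqP->|gs] ->; [left|right; exists g].
exists e; split=> //; exists (fun h => u h * e); split.
  move=> g h /=; rewrite uM [RHS]mulgA -(mulgA _ e (u h)) -ue.
  by rewrite !mulgA -(mulgA _ e) ee.
split=> [h _|g h _ _ /= /(congr1 (@sigma _ _))|m [mmV Vmm]].
- split; last by rewrite invgM eV !mulgA -(mulgA e) Vu mulg1.
  by rewrite ue invgM eV !mulgA -(mulgA e) uV mulg1.
- rewrite !sigmaM (sigma_idem ee) !mulg1 => /sigma_inc_group_inj.
  exact: f_inj.
rewrite eV ee in mmV Vmm.
have em : edges m = edges e by rewrite -edges_mulgV mmV.
have es : edges e = shift (sigma m) (edges e).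
  by rewrite -[in RHS]Vmm edges_mulVg shiftM mulgV shift1 em.
(* As 1 is an edge origin of [e], its translate [sigma m] is one too, hence the image of some
   [h]. *)
have : edges e (sigma m).
  rewrite es; exists 1; last by rewrite mulg1.
  rewrite edges_prod; exists 1; first by rewrite mem_enum.
  have : u 1 = 1 by rewrite -[LHS]mulg1 -(uV 1) mulgA -uM mulg1 uV.
  by move=> ->; rewrite sigma_idem // /idempotent_elt mulg1.
rewrite edges_prod => -[h _ mh].
(* By E-unitarity [n] is idempotent, so n = n n^-1 = (u h)^-1 e (u h) = e, that is, m = (u h) e. *)
pose n := (u h)^-1 * m.
have nn : idempotent_elt n.
  apply: (proj1 (@E_unitary_free_product B X S n)).
  by rewrite /n sigmaM sigmaV mh mulVg.
exists h => //=; rewrite -[RHS]mul1g -(uV h) -mulgA -/n; congr (_ * _).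
rewrite -nn -{2}(idem_inv nn) /n invgM invgK !mulgA -(mulgA (u h)^-1 m).
by rewrite mmV -mulgA -ue mulgA Vu mul1g.
Qed.

End TraversedEdges.

(** * Finitary permutations as products of adjacent transpositions *)

Section Transpositions.

Definition swap (i m : nat) : nat :=
  if m == i then i.+1 else if m == i.+1 then i else m.

Definition swaps (w : seq nat) (m : nat) : nat :=
  foldl (fun m i => swap i m) m w.

Lemma swaps_cat v w m : swaps (v ++ w) m = swaps w (swaps v m).
Proof. exact: foldl_cat. Qed.

Lemma swapK i : involutive (swap i).
Proof. by rewrite /swap => m; do !case: eqP => //; lia. Qed.

Lemma swaps_revK w m : swaps (rev w) (swaps w m) = m.
Proof.
elim: w m => // i w ih m; rewrite rev_cons -cats1 swaps_cat.
by rewrite [swaps (i :: w) m]/(swaps w (swap i m)) ih /swaps /= swapK.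
Qed.

Lemma swaps_inj w : injective (swaps w).
Proof. exact: can_inj (swaps_revK w). Qed.

Lemma swaps_iota k d : swaps (iota k d) k = k + d.
Proof.
elim: d k => [|d ih] k; first by rewrite addn0.
by rewrite /swaps /= -/(swaps _ _) /swap eqxx ih addnS.
Qed.

Lemma swaps_iota_out k d m : k + d < m -> swaps (iota k d) m = m.
Proof.
elim: d k => [//|d ih] k km.
by rewrite /swaps /= -/(swaps _ _) {1}/swap !gtn_eqF ?ih //; lia.
Qed.

(** Induction on [n]: composing [p] with the run of swaps that carries [p n] up to [n] gives a
    permutation that also fixes [n]. Undoing the run afterwards recovers [p]. *)
Lemma perm_swaps n (p : nat -> nat) : injective p ->
  (forall m, n <= m -> p m = m) -> exists w, forall m, swaps w m = p m.
Proof.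
elim: n p => [|n ih] p p_inj pE; first by exists [::] => m; rewrite pE.
have pn : p n <= n.
  by rewrite leqNgt; apply/negP => /[dup]/pE/p_inj => ->; rewrite ltnn.
pose v := iota (p n) (n - p n).
have [||w wE] := ih (fun m => swaps v (p m)).
- by move=> x y /swaps_inj/p_inj.
- move=> m; rewrite leq_eqVlt => /orP[/eqP<-|nm].
    by rewrite swaps_iota subnKC.
  by rewrite pE // swaps_iota_out // subnKC.
by exists (w ++ rev v) => m; rewrite swaps_cat wE swaps_revK.
Qed.

End Transpositions.

(** * Coxeter relations and the embedding of finite groups *)

Section CoxeterGenerators.
Variables (G : groupType) (T : Type) (act : T -> G -> T) (pt : nat -> T).
Variable s : nat -> G.
Hypothesis act1 : forall x, act x 1 = x.
Hypothesis actM : forall x g h, act x (g * h) = act (act x g) h.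
Hypothesis pt_inj : injective pt.
Hypothesis act_s : forall i m, act (pt m) (s i) = pt (swap i m).
Hypothesis ss : forall i, s i * s i = 1.
Hypothesis s_braid : forall i, s i * s i.+1 * s i = s i.+1 * s i * s i.+1.
Hypothesis s_comm : forall i j, i.+1 < j -> s i * s j = s j * s i.

Definition sprod (w : seq nat) : G := \prod_(i <- w) s i.

Lemma sprod_cat v w : sprod (v ++ w) = sprod v * sprod w.
Proof. exact: big_cat. Qed.

Lemma sprod_revK w : sprod w * sprod (rev w) = 1.
Proof.
elim: w => [|i w ih]; first by rewrite /sprod !big_nil mulg1.
rewrite rev_cons -cats1 -cat1s !sprod_cat -mulgA (mulgA (sprod w)) ih mul1g.
by rewrite /sprod !big_seq1 ss.
Qed.

Lemma act_sprod w m : act (pt m) (sprod w) = pt (swaps w m).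
Proof.
elim: w m => [|i w ih] m; first by rewrite /sprod big_nil act1.
by rewrite -cat1s sprod_cat actM /sprod big_seq1 act_s ih.
Qed.

(** This is s_(k+d-1) ... s_(k+1) s_k, which carries the point k + d down to k. *)
Fixpoint descent (k d : nat) : G :=
  if d is d'.+1 then descent k.+1 d' * s k else 1.

Lemma descent_comm i k d : i.+1 < k -> s i * descent k d = descent k d * s i.
Proof.
elim: d k => [|d ih] k ik /=; first by rewrite mulg1 mul1g.
by rewrite mulgA ih 1?ltnW // -!mulgA s_comm.
Qed.

(** Moving left, s_(i+1) commutes with the factors of index below i and meets s_(i+1) s_i; the braid
    relation releases s_i on the left, which commutes with the remaining factors. *)
Lemma descent_shift i k d : k <= i -> i.+1 < k + d ->
  descent k d * s i.+1 = s i * descent k d.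
Proof.
elim: d k => [|d ih] k /=; first by lia.
rewrite leq_eqVlt => /orP[/eqP ik|ki] id; last first.
  by rewrite -mulgA s_comm // mulgA ih // ?mulgA //; lia.
case: d ih id => [|d] ih id; first by lia.
rewrite -ik /= -!mulgA (mulgA (s k.+1)) -s_braid !mulgA descent_comm //.
Qed.

(* Coset representatives of the symmetric group on [0, n) in the one on
   [0, n], indexed by the image k of n. *)
Lemma sprod_coset n w : all (fun i => i < n) w ->
  exists k d v, [/\ k + d = n, all (fun i => i.+1 < n) v,
    sprod w = sprod v * descent k d & swaps w n = k].
Proof.
elim/last_ind: w => [_|w i ih].
  by exists n, 0, [::]; rewrite addn0 /sprod !big_nil mulg1.
rewrite all_rcons => /andP[ltin /ih [k [d [v [kd vn wE wk]]]]].
have sprod1 j : sprod [:: j] = s j by rewrite /sprod big_seq1.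
rewrite -cats1 sprod_cat swaps_cat wk wE sprod1 [swaps _ k]/(swap i k).
(* For k < i, the new s_i passes the descent as s_(i-1); for k = i + 1 it lengthens the descent; for
   k > i + 1 it commutes with it; for k = i it cancels the last factor. *)
rewrite /swap; case: (ltngtP k i) => [ki|ik|eki].
- case: i ltin ki => // i ltin ki.
  exists k, d, (rcons v i); split=> //.
  + by rewrite all_rcons ltin.
  + rewrite -cats1 sprod_cat sprod1 -!mulgA.
    by rewrite descent_shift // kd.
  + by rewrite ltn_eqF // ltnS ltnW.
- case: (eqVneq k i.+1) => [eki|nki].
    exists i, d.+1, v; split=> //; first by lia.
    by rewrite /= -eki mulgA.
  have ik1 : i.+1 < k by lia.
  exists k, d, (rcons v i); split=> //.
    by rewrite all_rcons vn andbT; lia.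
  by rewrite -cats1 sprod_cat sprod1 -!mulgA descent_comm.
- case: d kd wE => [|d] kd wE; first by lia.
  exists k.+1, d, v; split=> //; first by lia.
    by rewrite /= -eki -!mulgA ss mulg1.
  by rewrite eki.
Qed.

(** In the coset decomposition the descent is empty because [w] fixes the top point, so one
    generator fewer is involved. The action shows that the remaining word still induces the
    identity. *)
Lemma sprod_trivial w : swaps w =1 id -> sprod w = 1.
Proof.
have [n] : exists n, all (fun i => i < n) w.
  exists (\max_(i <- w) i).+1; apply/allP => i iw.
  by rewrite ltnS; exact: (@leq_bigmax_seq _ w xpredT id).
elim: n w => [|n ih] w wn w1.
  by case: w wn {w1} => // _; rewrite /sprod big_nil.
have [k [d [v [kd vn wE wk]]]] := sprod_coset wn.
move: wk; rewrite w1 => kE; have d0 : d = 0 by lia.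
have vE : sprod w = sprod v by rewrite wE d0 mulg1.
rewrite vE; apply: ih; first exact: vn.
by move=> m; apply: pt_inj; rewrite -act_sprod -vE act_sprod w1.
Qed.

Lemma sprod_eq v w : swaps v =1 swaps w -> sprod v = sprod w.
Proof.
move=> vw; have: sprod (v ++ rev w) = 1.
  by apply: sprod_trivial => m; rewrite swaps_cat vw swaps_revK.
rewrite sprod_cat => vw1; apply: (mulIg (sprod (rev w))).
by rewrite sprod_revK.
Qed.

(** Cayley's theorem: right translations of [H] are permutations of the ranks below [#|H|], written
    as words in the generators. [sprod_eq] makes the choice of words multiplicative. *)
Lemma finite_group_embedding (H : finGroupType) :
  exists f : H -> G, {morph f : g h / g * h} /\ injective f.
Proof.
pose p (h : H) (m : nat) : nat :=
  if insub m is Some i then enum_rank (enum_val (i : 'I_#|H|) * h : H) : nat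
  else m.
have pr (g h : H) : p h (enum_rank g) = enum_rank (g * h).
  by rewrite /p valK enum_rankK.
have p_out h m : #|H| <= m -> p h m = m.
  by move=> Hm; rewrite /p insubN // -leqNgt.
have rankP (m : nat) : (exists g : H, m = enum_rank g) \/ #|H| <= m.
  case: (ltnP m #|H|) => [mH|]; [left|by right].
  by exists (enum_val (Ordinal mH)); rewrite enum_valK.
have pM g h m : p (g * h) m = p h (p g m).
  by case: (rankP m) => [[k ->]|mH]; rewrite ?pr ?mulgA // !p_out.
have p1 m : p 1 m = m.
  by case: (rankP m) => [[k ->]|mH]; rewrite ?pr ?mulg1 // !p_out.
have p_inj h : injective (p h).
  by apply: (can_inj (g := p h^-1)) => m; rewrite -pM mulgV p1.
have /choice[w wE] h : exists w, forall m, swaps w m = p h m.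
  exact: perm_swaps (p_inj h) (p_out h).
(* The image of the rank of 1 is the rank of [h], which gives injectivity. *)
pose r1 : nat := enum_rank (1 : H).
exists (fun h => sprod (w h)); split=> [g h|g h /(congr1 (act (pt r1)))].
  rewrite -sprod_cat; apply: sprod_eq => m.
  by rewrite swaps_cat !wE pM.
rewrite !act_sprod => /pt_inj; rewrite !wE !pr !mul1g.
by move=> /ord_inj/enum_rank_inj.
Qed.

End CoxeterGenerators.

(* If s_0 = s and s_k is the conjugate of s by t^k, the last three hypotheses
   make u act as t on all s_k with k >= 2, as in the finite presentation of
   Thompson's group F. Since u commutes with s, one commutation [s, s_2] = 1
   yields all of them. *)
Section ShiftedConjugates.
Variables (G : groupType) (s t u : G).
Let sk k := s ^ (t ^+ k).
Hypothesis sksk : s * s = 1.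
Hypothesis braid : s * sk 1 * s = sk 1 * s * sk 1.
Hypothesis comm_s_s2 : s * sk 2 = sk 2 * s.
Hypothesis comm_s_u : s * u = u * s.
Hypothesis s2u : sk 2 ^ u = sk 3.
Hypothesis s3u : sk 3 ^ u = sk 4.
Hypothesis tu : (u ^ t) ^ u = (u ^ t) ^ t.

Lemma shifted_conj k : sk k ^ t = sk k.+1.
Proof. by rewrite /sk -conjgM expgSr. Qed.

Lemma shifted_conjD i k : sk k ^ (t ^+ i) = sk (k + i).
Proof. by rewrite /sk -conjgM -expgnDr. Qed.

(** Two consecutive cases give the next. The first, conjugated by t, says that u^t takes s_(k+3) to
    s_(k+4); so s_(k+4)^u is s_(k+4) conjugated by (u^t)^u = (u^t)^t, which is s_(k+5). *)
Lemma shifted_conj_u k : sk k.+2 ^ u = sk k.+3.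
Proof.
suff [] : sk k.+2 ^ u = sk k.+3 /\ sk k.+3 ^ u = sk k.+4 by [].
elim: k => [//|k [e2 e3]]; split=> //.
have e : sk k.+3 ^ (u ^ t) = sk k.+4.
  by rewrite -shifted_conj -conjJg e2 shifted_conj.
by rewrite -[in LHS]e conjJg e3 tu -shifted_conj -conjJg e shifted_conj.
Qed.

Lemma shifted_comm i j : i.+1 < j -> sk i * sk j = sk j * sk i.
Proof.
move=> ij; have comm0 k : s * sk k.+2 = sk k.+2 * s.
  elim: k => [//|k ih]; rewrite -shifted_conj_u.
  have su : s ^ u = s by rewrite conjgE comm_s_u mulKg.
  by rewrite -[in LHS]su -[in RHS]su -!conjMg ih.
have -> : j = (j - i.+2).+2 + i by lia.
by rewrite -shifted_conjD {1 3}/sk -!conjMg comm0.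
Qed.

Lemma shifted_sq i : sk i * sk i = 1.
Proof. by rewrite /sk -conjMg sksk conj1g. Qed.

Lemma shifted_braid i : sk i * sk i.+1 * sk i = sk i.+1 * sk i * sk i.+1.
Proof. by rewrite -add1n -shifted_conjD {1 3 5}/sk -!conjMg braid. Qed.

End ShiftedConjugates.

(** * The finite presentation of the group *)

Local Notation letter := (option bool).
Definition word_s : word letter := [:: (None, false)].
Definition word_t : word letter := [:: (Some false, false)].
Definition word_u : word letter := [:: (Some true, false)].

Definition conjw (w v : word letter) : word letter := winv v ++ w ++ v.

Definition word_sk (k : nat) : word letter :=
  iter k (fun w => conjw w word_t) word_s.

(** These are the hypotheses of [ShiftedConjugates], in the same order. *)
Definition eqns : seq (word letter * word letter) :=
  let s1 := word_sk 1 in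
  let u1 := conjw word_u word_t in
  [:: (word_s ++ word_s, [::]);
      (word_s ++ s1 ++ word_s, s1 ++ word_s ++ s1);
      (word_s ++ word_sk 2, word_sk 2 ++ word_s);
      (word_s ++ word_u, word_u ++ word_s);
      (conjw (word_sk 2) word_u, word_sk 3);
      (conjw (word_sk 3) word_u, word_sk 4);
      (conjw u1 word_u, conjw u1 word_t)].

(** Each equation is rewritten as v w^-1 = 1 to make the presentation special. *)
Definition eqns_rel : set (word letter * word letter) :=
  (fun p => (p.1 ++ winv p.2, [::])) @` [set` eqns].

(** * The action on the rational line *)

Section RationalAction.
Local Open Scope ring_scope.
Import Order.TTheory GRing.Theory Num.Theory.

(* The standard generators of Thompson's group F acting on the line, and a
   transposition of two integers. *)
Definition stretch (q : rat) : rat :=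
  if q <= 1 then q else if q <= 2 then 2 * q - 1 else q + 1.

Definition unstretch (q : rat) : rat :=
  if q <= 1 then q else if q <= 3 then (q + 1) / 2 else q - 1.

Definition rat_swap (a b q : rat) : rat :=
  if q == a then b else if q == b then a else q.

Definition letter_act (q : rat) (l : letter * bool) : rat :=
  match l with
  | (None, _) => rat_swap 0 1 q
  | (Some false, b) => if b then q - 1 else q + 1
  | (Some true, b) => if b then unstretch q else stretch q
  end.

Definition word_act (q : rat) (w : word letter) : rat := foldl letter_act q w.

Lemma word_act_cat q v w : word_act q (v ++ w) = word_act (word_act q v) w.
Proof. exact: foldl_cat. Qed.

Lemma stretchK : cancel stretch unstretch.
Proof.
rewrite /unstretch /stretch => q.
by case: (lerP q 1) => ?; [|case: (lerP q 2) => ?]; do 2?[case: lerP => ?]; lra.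
Qed.

Lemma unstretchK : cancel unstretch stretch.
Proof.
rewrite /unstretch /stretch => q.
by case: (lerP q 1) => ?; [|case: (lerP q 3) => ?]; do 2?[case: lerP => ?]; lra.
Qed.

Lemma stretch_le q : q <= 1 -> stretch q = q.
Proof. by rewrite /stretch => ->. Qed.

Lemma stretch_ge q : 2 <= q -> stretch q = q + 1.
Proof. by move=> ?; rewrite /stretch; do 2?[case: lerP => ?]; lra. Qed.

Lemma stretch_ge1 q : 1 <= q -> 1 <= stretch q.
Proof.
move=> q1; rewrite /stretch; case: (lerP q 1) => //.
by case: (lerP q 2) => ?; lra.
Qed.

Lemma unstretch_ge q : 3 < q -> unstretch q = q - 1.
Proof. by move=> ?; rewrite /unstretch; do 2?[case: lerP => ?]; lra. Qed.

Lemma unstretch_le q : q <= 3 -> unstretch q <= 2.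
Proof.
by move=> q3; rewrite /unstretch q3; case: (lerP q 1) => ?; lra.
Qed.

Lemma rat_swap_conj (f g : rat -> rat) a b q : cancel f g -> cancel g f ->
  f (rat_swap a b (g q)) = rat_swap (f a) (f b) q.
Proof.
move=> fK gK; rewrite /rat_swap !(can2_eq gK fK).
by case: eqP => // _; case: eqP.
Qed.

Lemma rat_swapK a b : involutive (rat_swap a b).
Proof.
move=> q; rewrite /rat_swap.
case: (eqVneq q a) => [->|qa]; first by rewrite eqxx; case: eqVneq.
case: (eqVneq q b) => [->|qb]; first by rewrite eqxx.
by rewrite (negbTE qa) (negbTE qb).
Qed.

Lemma rat_swap_braid a b c q : a != b -> a != c -> b != c ->
  rat_swap a b (rat_swap b c (rat_swap a b q)) =
  rat_swap b c (rat_swap a b (rat_swap b c q)).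
Proof.
move=> ab ac bc; pose d := (negbTE ab, negbTE ac, negbTE bc).
pose d' := (eq_sym b a, eq_sym c a, eq_sym c b).
rewrite /rat_swap; case: (eqVneq q a) => [->|qa].
  by rewrite ?(eqxx, d', d).
case: (eqVneq q b) => [_|qb]; first by rewrite ?(eqxx, d', d).
case: (eqVneq q c) => [->|qc]; first by rewrite ?(eqxx, d', d).
by rewrite ?(negbTE qa, negbTE qb, negbTE qc).
Qed.

Lemma rat_swap_comm a b c d q : a != c -> a != d -> b != c -> b != d ->
  rat_swap a b (rat_swap c d q) = rat_swap c d (rat_swap a b q).
Proof.
move=> ac ad bc bd; pose e := (negbTE ac, negbTE ad, negbTE bc, negbTE bd).
pose e' := (eq_sym c a, eq_sym d a, eq_sym c b, eq_sym d b).
rewrite /rat_swap; case: (eqVneq q a) => [->|qa].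
  by rewrite ?(eqxx, e', e).
case: (eqVneq q b) => [qb|qb].
  by rewrite qb in qa *; rewrite ?(eqxx, e', e, negbTE qa).
case: (eqVneq q c) => [_|qc]; first by rewrite ?(eqxx, e', e).
case: (eqVneq q d) => [_|qd]; first by rewrite ?(eqxx, e', e).
by rewrite ?(negbTE qa, negbTE qb).
Qed.

Lemma letter_actK q l : letter_act (letter_act q l) (l.1, ~~ l.2) = q.
Proof.
case: l => [[[]|] []] /=; rewrite ?stretchK ?unstretchK ?addrK ?subrK //.
  exact: rat_swapK.
exact: rat_swapK.
Qed.

Lemma word_act_winv q w : word_act (word_act q w) (winv w) = q.
Proof.
elim: w q => //= l w ih q.
by rewrite winv_cons word_act_cat ih; apply: letter_actK.
Qed.

Lemma word_act_sk q k : word_act q (word_sk k) = rat_swap k%:R k.+1%:R q.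
Proof.
elim: k q => [//|k ih] q.
rewrite [word_sk _]/(conjw (word_sk k) word_t) !word_act_cat ih /=.
rewrite (rat_swap_conj _ _ _ (f := +%R^~ 1) (g := fun x => x - 1)) ?natr1 //.
  exact: addrK.
exact: subrK.
Qed.

Lemma word_act_sk_cat q k w :
  word_act q (word_sk k ++ w) = word_act (rat_swap k%:R k.+1%:R q) w.
Proof. by rewrite word_act_cat word_act_sk. Qed.

(** From 2 on, [stretch] is translation by 1, so conjugation by u moves the transposition of k and k
    + 1 as t does. *)
Lemma word_act_sk_u q k : (1 < k)%N ->
  word_act q (conjw (word_sk k) word_u) = word_act q (word_sk k.+1).
Proof.
move=> k2; rewrite (word_act_sk q k.+1) !word_act_cat word_act_sk /=.
rewrite (rat_swap_conj _ _ _ stretchK unstretchK).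
have k2' : 2 <= k%:R :> rat by rewrite ler_nat.
have k3 : 2 <= k.+1%:R :> rat by rewrite ler_nat ltnW.
by rewrite !stretch_ge // !natr1.
Qed.

Lemma word_act_eqns p q : p \in eqns -> word_act q p.1 = word_act q p.2.
Proof.
rewrite !inE => /or4P[/eqP->|/eqP->|/eqP->|/or4P[/eqP->|/eqP->|/eqP->|/eqP->]].
- exact: rat_swapK.
- rewrite -[LHS]/(word_act q (word_sk 0 ++ word_sk 1 ++ word_sk 0)).
  rewrite -[RHS]/(word_act q (word_sk 1 ++ word_sk 0 ++ word_sk 1)).
  by rewrite !word_act_sk_cat !word_act_sk; apply: rat_swap_braid.
- rewrite -[LHS]/(word_act q (word_sk 0 ++ word_sk 2)).
  rewrite -[RHS]/(word_act q (word_sk 2 ++ word_sk 0)).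
  by rewrite !word_act_sk_cat !word_act_sk; apply/esym/rat_swap_comm.
(* [stretch] fixes both 0 and 1, hence commutes with their transposition. *)
- rewrite !word_act_cat /=.
  have := rat_swap_conj 0 1 (stretch q) stretchK unstretchK.
  by rewrite stretchK (@stretch_le 0) // (@stretch_le 1).
- exact: word_act_sk_u.
- exact: word_act_sk_u.
(* Up to 3 both sides fix [q]. Beyond 3, u^-1 subtracts 1 as t^-1 does, and the last u acts on a
   number at least 2, so it adds 1 as t does. *)
- rewrite /=; case: (lerP q 3) => q3.
    have v1 : unstretch q - 1 <= 1 by have := unstretch_le q3; lra.
    have q1 : q - 1 - 1 <= 1 by lra.
    by rewrite (stretch_le v1) (stretch_le q1) !subrK unstretchK.
  rewrite unstretch_ge // stretch_ge //.
  have : 1 <= q - 1 - 1 by lra.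
  by move=> /stretch_ge1; lra.
Qed.

End RationalAction.

(** * Finite subgroups of the presented group, and the final monoid *)

Local Notation gp := (Gp_class eqns_rel).

Lemma word_act_Gp u v q : gp u = gp v -> word_act q u = word_act q v.
Proof.
move=> /Gp_class_eq uv; elim: uv q => {u v} [u v|//|u v _ E q|
  u v w _ E _ E' q|u u' v v' _ E _ E' q].
- case=> [[w [-> ->]] q|[[u' v'] /= uv' [<- <-]] q].
    by rewrite word_act_cat word_act_winv.
  by rewrite word_act_cat (word_act_eqns q uv') word_act_winv.
- by rewrite E.
- by rewrite E E'.
- by rewrite !word_act_cat E E'.
Qed.

Lemma Gp_class_eqns u v : (u, v) \in eqns -> gp u = gp v.
Proof.
move=> uv; apply: (mulIg (gp v)^-1); rewrite mulgV Gp_invE -Gp_class_cat.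
by apply/Gp_class_eq/cong_rel; right; exists (u, v).
Qed.

Lemma Gp_class_conjw w v : gp (conjw w v) = gp w ^ gp v.
Proof. by rewrite !Gp_class_cat -Gp_invE. Qed.

Lemma Gp_class_sk k : gp (word_sk k) = gp word_s ^ (gp word_t ^+ k).
Proof.
elim: k => [|k ih]; first by rewrite conjg1.
rewrite -[word_sk k.+1]/(conjw (word_sk k) word_t) Gp_class_conjw ih.
by rewrite -conjgM -expgSr.
Qed.

Lemma finite_group_in_eqns (H : finGroupType) :
  exists f : H -> GpPres eqns_rel, {morph f : g h / g * h} /\ injective f.
Proof.
pose s := gp word_s; pose t := gp word_t; pose u := gp word_u.
have eqn w v : (w, v) \in eqns -> gp w = gp v := @Gp_class_eqns w v.
pose gpE := (Gp_class_sk, Gp_class_conjw, Gp_class_cat, mulgA).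
have e0 : s * s = 1 by rewrite -Gp_class_cat; apply: eqn.
have e1 : s * s ^ (t ^+ 1) * s = s ^ (t ^+ 1) * s * s ^ (t ^+ 1).
  have := eqn (word_s ++ word_sk 1 ++ word_s) (word_sk 1 ++ word_s ++ word_sk 1).
  by rewrite !gpE => ->.
have e2 : s * s ^ (t ^+ 2) = s ^ (t ^+ 2) * s.
  have := eqn (word_s ++ word_sk 2) (word_sk 2 ++ word_s).
  by rewrite !gpE => ->.
have e3 : s * u = u * s by rewrite -!Gp_class_cat; apply: eqn.
have e4 : (s ^ (t ^+ 2)) ^ u = s ^ (t ^+ 3).
  by rewrite -!Gp_class_sk -Gp_class_conjw; apply: eqn.
have e5 : (s ^ (t ^+ 3)) ^ u = s ^ (t ^+ 4).
  by rewrite -!Gp_class_sk -Gp_class_conjw; apply: eqn.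
have e6 : (u ^ t) ^ u = (u ^ t) ^ t.
  have := eqn (conjw (conjw word_u word_t) word_u)
              (conjw (conjw word_u word_t) word_t).
  by rewrite !Gp_class_conjw => ->.
have actE q w : word_act q (repr (gp w)) = word_act q w.
  by apply: word_act_Gp; rewrite Gp_class_repr.
(* The natural numbers inside the rational line are the points permuted by the s_k. *)
apply: (@finite_group_embedding (GpPres eqns_rel) rat
  (fun q g => word_act q (repr g)) (fun n => n%:R%R) (fun k => s ^ (t ^+ k))
  _ _ _ _ _ _ _ H).
- by move=> q; rewrite -Gp_class_nil actE.
- move=> q g h; rewrite -[g]Gp_class_repr -[h]Gp_class_repr -Gp_class_cat.
  by rewrite !actE word_act_cat.
- by move=> m n /eqP; rewrite Num.Theory.eqr_nat => /eqP.
- move=> i m; rewrite -Gp_class_sk actE word_act_sk /rat_swap /swap.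
  by rewrite !Num.Theory.eqr_nat; case: eqP => // _; case: eqP.
- exact: shifted_sq.
- exact: shifted_braid.
- exact: (shifted_comm e2 e3 e4 e5 e6).
Qed.

Theorem corollary5p12 :
  exists (A : finType) (R : set (word A * word A)),
    [/\ finite_set R,
        special R,
        E_unitary R,
        (exists (B : finType) (S : set (word B * word B)) (X : finType)
           (i : GpPres S -> InvPres R) (j : FreeInv X -> InvPres R),
           finite_set S /\ is_free_product i j) &
        forall H : finGroupType,
          exists e : InvPres R, idempotent_elt e /\ isog_Hclass H e].
Proof.
have fin : finite_set eqns_rel by apply: finite_image; exact: finite_seq.
exists (letter + unit)%type, (@free_product_rel letter unit eqns_rel); split.
- rewrite finite_setU; split; last exact: finite_image.
  by apply: finite_image; exact: finite_finset.
- by apply: special_free_product => u v [p _ [_ <-]].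
- exact: E_unitary_free_product.
- exists letter, eqns_rel, unit.
  exists (@inc_group letter unit eqns_rel), (@inc_free letter unit eqns_rel).
  by split=> //; exact: free_product_univ.
- move=> H; have [f [fM f_inj]] := finite_group_in_eqns H.
  exact: isog_Hclass_subgroup tt fM f_inj.
Qed.
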